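(* Let $f,g\in\mathbb{R}^N$ be signals on the point cloud and $\alpha\in\mathbb{R}$. The $\alpha$-order spectral convolution of $\hat f^{(\alpha)}$ and $\hat g^{(\alpha)}$ equals the PMFHT of the element-wise spatial product of the signals: $$\hat f^{(\alpha)}\circledast_\alpha^*\hat g^{(\alpha)}=\widehat{(f\odot g)}^{(\alpha)}.$$
   Context: Discrete Laplace–Beltrami data. Let $P=\{p_1,\dots,p_N\}\subset\mathbb{R}^3$ be a point cloud sampled from a surface and let $t>0$. For each $i$, let $\hat T_{p_i}$ be the estimated tangent plane at $p_i$ (best-fitting plane to the points of $P$ in a ball around $p_i$), and let $b_{ii}>0$ be the area of the Voronoi cell of $p_i$ in the planar Voronoi diagram, on $\hat T_{p_i}$, of the projections of the points of $P$ in a ball $B(p_i,\delta)$. Let $B=\mathrm{diag}(b_{11},\dots,b_{NN})$ (mass matrix) and let $Q$ be the real symmetric matrix with $q_{ij}=\frac{b_{ii}b_{jj}}{4\pi t^2}\exp(-\|p_i-p_j\|^2/(4t))$ for $i\ne j$ and $q_{ii}=-\sum_{j\neq i}q_{ij}$. Let $H\in\mathbb{R}^{N\times N}$ be a matrix whose columns $H_i$ are generalized eigenvectors, $QH_i=-\lambda_i BH_i$, normalized so that $H^\top BH=I$. Fractional transform. Put $F_M:=H^\top B^{1/2}$, a real orthogonal matrix. Fix a spectral decomposition $F_M=V\Omega V^*$ with $V$ unitary and $\Omega=\mathrm{diag}(\omega_1,\dots,\omega_N)$, $|\omega_i|=1$. For $\alpha\in\mathbb{R}$ put $F_M^{(\alpha)}:=V\Omega^\alpha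 V^*$ with $\Omega^\alpha=\mathrm{diag}(\omega_1^\alpha,\dots,\omega_N^\alpha)$, where $\omega_i^\alpha:=e^{\mathrm{i}\alpha\theta_i}$ for a choice of real argument $\theta_i$ of $\omega_i$ fixed once for all $\alpha$. The point cloud manifold fractional harmonic transform (PMFHT) of order $\alpha$ of a signal $f$ is $\hat f^{(\alpha)}:=F_M^{(\alpha)}(B^{1/2}f)\in\mathbb{C}^N$, with entries indexed $\hat f^{(\alpha)}(k)$, $k=0,\dots,N-1$; the inverse is $f=B^{-1/2}F_M^{(-\alpha)}\hat f^{(\alpha)}$. Spectral translation and convolution. Let $F_{M,k}^{(-\alpha)}$, $k=0,\dots,N-1$, be the columns of $F_M^{(-\alpha)}$ and let $\odot$ be element-wise (Hadamard) multiplication. The $\alpha$-order generalized spectral translation of $\hat g^{(\alpha)}$ by index $k$ is $\mathcal{S}_k^{(\alpha)}\hat g^{(\alpha)}:=F_M^{(\alpha)}\bigl(F_{M,k}^{(-\alpha)}\odot g\bigr)$. The $\alpha$-order spectral convolution is $\hat f^{(\alpha)}\circledast_\alpha^*\hat g^{(\alpha)}:=\sum_{k=0}^{N-1}\hat f^{(\alpha)}(k)\,\mathcal{S}_k^{(\alpha)}\hat g^{(\alpha)}$. *)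

(* Defs.v *)
From HB Require Import structures.
From mathcomp Require Import all_boot all_order all_algebra.
From mathcomp Require Import all_classical all_reals all_analysis.
From mathcomp Require Import complex.

Set Implicit Arguments.
Unset Strict Implicit.
Unset Printing Implicit Defensive.

Import Order.TTheory GRing.Theory Num.Theory.

Local Open Scope classical_set_scope.
Local Open Scope ring_scope.
Local Open Scope complex_scope.
Local Open Scope sesquilinear_scope.

(* The library norm on matrices is the sup norm, hence an explicit Euclidean
   structure on R^3. *)
Definition dot (R : realType) n (u v : 'rV[R]_n) : R := \sum_j u 0 j * v 0 j.

Definition enorm (R : realType) n (u : 'rV[R]_n) : R := Num.sqrt (dot u u).

(* An affine plane of R^3, given by a point and an orthonormal frame of its
   direction.  The notions below do not depend on the frame chosen. *)
Record plane (R : realType) := Plane {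
  origin : 'rV[R]_3;
  dir1 : 'rV[R]_3;
  dir2 : 'rV[R]_3;
  dir1_unit : dot dir1 dir1 = 1;
  dir2_unit : dot dir2 dir2 = 1;
  dir_orth : dot dir1 dir2 = 0
}.

Definition plane_point (R : realType) (T : plane R) (x : R * R) : 'rV[R]_3 :=
  origin T + x.1 *: dir1 T + x.2 *: dir2 T.

Definition proj (R : realType) (T : plane R) (y : 'rV[R]_3) : 'rV[R]_3 :=
  plane_point T (dot (y - origin T) (dir1 T), dot (y - origin T) (dir2 T)).

Definition plane_area (R : realType) (T : plane R) (S : set 'rV[R]_3) : \bar R :=
  (lebesgue_measure \x lebesgue_measure)%E (plane_point T @^-1` S).

Section PointCloud.
Variables (R : realType) (N : nat) (p : 'I_N -> 'rV[R]_3).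

Definition fit_error (c : 'rV[R]_3) (r : R) (T : plane R) : R :=
  \sum_(j < N | enorm (p j - c) < r) enorm (p j - proj T (p j)) ^+ 2.

(* best fit in the sense of (orthogonal) least squares *)
Definition best_fitting_plane (c : 'rV[R]_3) (r : R) (T : plane R) : Prop :=
  forall T' : plane R, fit_error c r T <= fit_error c r T'.

Definition voronoi_cell (T : plane R) (delta : R) (i : 'I_N) : set 'rV[R]_3 :=
  [set y | range (plane_point T) y /\
     forall j, enorm (p j - p i) < delta ->
       enorm (y - proj T (p i)) <= enorm (y - proj T (p j))].

Variables (t : R) (b : 'I_N -> R).

Definition mass_mx : 'M[R]_N := diag_mx (\row_i b i).

Definition stiff_coef (i j : 'I_N) : R :=
  b i * b j / (4 * pi * t ^+ 2) * expR (- (enorm (p i - p j) ^+ 2 / (4 * t))).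

Definition stiff_mx : 'M[R]_N :=
  \matrix_(i, j) if i == j then - \sum_(k < N | k != i) stiff_coef i k
                 else stiff_coef i j.

End PointCloud.

Definition mass_sqrt (R : realType) N (b : 'I_N -> R) : 'M[R]_N :=
  diag_mx (\row_i Num.sqrt (b i)).

Definition mass_invsqrt (R : realType) N (b : 'I_N -> R) : 'M[R]_N :=
  diag_mx (\row_i (Num.sqrt (b i))^-1).

Definition harmonic_mx (R : realType) N (b : 'I_N -> R) (H : 'M[R]_N) : 'M[R]_N :=
  H^T *m mass_sqrt b.

Definition toC_mx (R : realType) m n (A : 'M[R]_(m, n)) : 'M[R[i]]_(m, n) :=
  map_mx (real_complex R) A.

(* e^{i x} *)
Definition cis (R : realType) (x : R) : R[i] := cos x +i* sin x.

Definition hadamard (K : pzRingType) m n (A B : 'M[K]_(m, n)) : 'M[K]_(m, n) :=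
  map2_mx *%R A B.

Section Fractional.
(* V diagonalizes the harmonic matrix, and theta lists the chosen arguments of
   its eigenvalues, so that omega_i^alpha = e^{i alpha theta_i}. *)
Variables (R : realType) (N : nat) (b : 'I_N -> R).
Variables (V : 'M[R[i]]_N) (theta : 'I_N -> R).

Definition frac_mx (alpha : R) : 'M[R[i]]_N :=
  V *m diag_mx (\row_i cis (alpha * theta i)) *m V^t*.

Definition pmfht (alpha : R) (f : 'cV[R]_N) : 'cV[R[i]]_N :=
  frac_mx alpha *m toC_mx (mass_sqrt b *m f).

Definition ipmfht (alpha : R) (fh : 'cV[R[i]]_N) : 'cV[R[i]]_N :=
  toC_mx (mass_invsqrt b) *m (frac_mx (- alpha) *m fh).

(* As an operator on the spectral signal gh, whose underlying spatial signal g
   is recovered by the inverse transform. *)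
Definition spectral_translation (alpha : R) (k : 'I_N) (gh : 'cV[R[i]]_N) :
    'cV[R[i]]_N :=
  frac_mx alpha *m hadamard (col k (frac_mx (- alpha))) (ipmfht alpha gh).

Definition spectral_convolution (alpha : R) (fh gh : 'cV[R[i]]_N) :
    'cV[R[i]]_N :=
  \sum_(k < N) fh k 0 *: spectral_translation alpha k gh.

End Fractional.

(* Main.v *)
Require Import Defs.
From HB Require Import structures.
From mathcomp Require Import all_boot all_order all_algebra.
From mathcomp Require Import all_classical all_reals all_analysis.
From mathcomp Require Import complex.

Set Implicit Arguments.
Unset Strict Implicit.
Unset Printing Implicit Defensive.

Import Order.TTheory GRing.Theory Num.Theory.

Local Open Scope ring_scope.
Local Open Scope complex_scope.
Local Open Scope sesquilinear_scope.

(** Write [F^a] for [frac_mx V theta a] and [D] for the square root of the mass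
    matrix.  Since [F^a] is linear and the Hadamard product is linear in its
    first factor, the spectral convolution of [fh] with the transform of [g]
    collapses to
      [F^a ((F^(-a) fh) o g)],
    a linear combination of the columns of [F^(-a)] being its product with the
    vector of coefficients ([sum_scale_hadamard_col]); that [g] itself appears
    is the inversion formula [pmfhtK].  The matrices [F^(-a)] and [F^a] are
    mutually inverse ([mul_frac_mxN]): [V] is unitary, and the inverse of the
    unit complex number [e^{i x}] is [e^{-i x}].  Hence, for [fh] the transform
    of [f], [F^(-a) fh] is [D f], and as [D] is diagonal,
    [(D f) o g = D (f o g)] ([hadamard_mul_diag]), whose image by [F^a] is the
    transform of [f o g]. *)

Lemma cisNM (R : realType) (x : R) : cis (- x) * cis x = 1.
Proof.
rewrite /cis cosN sinN; apply/eqP; rewrite eq_complex /=; apply/andP; split.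
  by rewrite mulNr opprK -!expr2 cos2Dsin2.
by rewrite mulNr [sin x * _]mulrC subrr.
Qed.

Lemma mul_frac_mxN (R : realType) (N : nat) (V : 'M[R[i]]_N)
    (theta : 'I_N -> R) (alpha : R) :
  V \is unitarymx ->
  frac_mx V theta (- alpha) *m frac_mx V theta alpha = 1%:M.
Proof.
move=> V_unitary; rewrite /frac_mx !mulmxA mulmxKtV //.
rewrite -[V *m _ *m _]mulmxA mulmx_diag.
under eq_mx do rewrite !mxE mulNr cisNM.
rewrite (_ : diag_mx _ = 1%:M) ?mulmx1; first exact/unitarymxP.
by apply/matrixP=> i j; rewrite !mxE.
Qed.

Lemma sum_scale_hadamard_col (K : comPzRingType) (m n : nat)
    (A : 'M[K]_(m, n)) (c : 'cV[K]_n) (u : 'cV[K]_m) :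
  \sum_(k < n) c k 0 *: hadamard (col k A) u = hadamard (A *m c) u.
Proof.
apply/matrixP=> i j; rewrite !ord1 summxE !mxE mulr_suml.
by apply: eq_bigr => k _; rewrite !mxE mulrA [c k 0 * _]mulrC.
Qed.

Lemma hadamard_mul_diag (K : pzRingType) (m n : nat) (d : 'rV[K]_m)
    (u v : 'M[K]_(m, n)) :
  hadamard (diag_mx d *m u) v = diag_mx d *m hadamard u v.
Proof. by rewrite !mul_diag_mx; apply/matrixP=> i j; rewrite !mxE mulrA. Qed.

Lemma toC_mx_hadamard (R : realType) (m n : nat) (u v : 'M[R]_(m, n)) :
  toC_mx (hadamard u v) = hadamard (toC_mx u) (toC_mx v).
Proof. by apply/matrixP=> i j; rewrite !mxE rmorphM. Qed.

Lemma mul_mass_invsqrt (R : realType) (N : nat) (b : 'I_N -> R) :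
  (forall i, 0 < b i) -> mass_invsqrt b *m mass_sqrt b = 1%:M.
Proof.
move=> b_gt0; rewrite mulmx_diag; apply/matrixP=> i j; rewrite !mxE.
by rewrite mulVf // gt_eqF // sqrtr_gt0.
Qed.

Lemma frac_mx_pmfhtK (R : realType) (N : nat) (b : 'I_N -> R)
    (V : 'M[R[i]]_N) (theta : 'I_N -> R) (alpha : R) (f : 'cV[R]_N) :
  V \is unitarymx ->
  frac_mx V theta (- alpha) *m pmfht b V theta alpha f =
    toC_mx (mass_sqrt b *m f).
Proof. by move=> V_unitary; rewrite mulmxA mul_frac_mxN // mul1mx. Qed.

(** The spectral translation is an operator on spectral data alone; inverting
    the transform is what identifies the factor it uses with the spatial
    signal [g]. *)
Lemma pmfhtK (R : realType) (N : nat) (b : 'I_N -> R)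
    (V : 'M[R[i]]_N) (theta : 'I_N -> R) (alpha : R) (g : 'cV[R]_N) :
  (forall i, 0 < b i) -> V \is unitarymx ->
  ipmfht b V theta alpha (pmfht b V theta alpha g) = toC_mx g.
Proof.
move=> b_gt0 V_unitary; rewrite /ipmfht frac_mx_pmfhtK // -map_mxM.
by rewrite mulmxA mul_mass_invsqrt // mul1mx.
Qed.

Theorem theorem4 (R : realType) (N : nat) (p : 'I_N -> 'rV[R]_3)
  (p_inj : injective p) (t : R) (t_gt0 : 0 < t)
  (r : 'I_N -> R) (r_gt0 : forall i, 0 < r i)
  (T : 'I_N -> plane R)
  (T_fit : forall i, best_fitting_plane p (p i) (r i) (T i))
  (delta : R) (delta_gt0 : 0 < delta)
  (b : 'I_N -> R) (b_gt0 : forall i, 0 < b i)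
  (b_area : forall i,
     (b i)%:E = plane_area (T i) (voronoi_cell p (T i) delta i))
  (H : 'M[R]_N) (lambda : 'I_N -> R)
  (H_eigen : forall i,
     stiff_mx p t b *m col i H = (- lambda i) *: (mass_mx b *m col i H))
  (H_norm : H^T *m mass_mx b *m H = 1%:M)
  (V : 'M[R[i]]_N) (V_unitary : V \is unitarymx)
  (omega : 'I_N -> R[i]) (omega_norm : forall i, `|omega i| = 1)
  (V_spectral :
     toC_mx (harmonic_mx b H) = V *m diag_mx (\row_i omega i) *m V^t*)
  (theta : 'I_N -> R) (theta_arg : forall i, omega i = cis (theta i))
  (f g : 'cV[R]_N) (alpha : R) :
  spectral_convolution b V theta alpha
    (pmfht b V theta alpha f) (pmfht b V theta alpha g)
  = pmfht b V theta alpha (hadamard f g).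
Proof.
rewrite /spectral_convolution.
under eq_bigr do rewrite /spectral_translation pmfhtK // scalemxAr.
rewrite -mulmx_sumr sum_scale_hadamard_col frac_mx_pmfhtK //.
by rewrite -toC_mx_hadamard hadamard_mul_diag.
Qed.
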